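(* Let $\alpha,\beta>0$ and let $k\ge1$. For the asymmetric annihilation process on $L$ sites with $L>k+1$, the stationary probability that the first $k$ sites are all occupied is $$\langle\eta_1\cdots\eta_k\rangle=\frac{\alpha^k}{2^{\binom k2}(1+2\alpha)^k}.$$
   Context: The model: a continuous-time Markov chain on configurations $\eta=(\eta_1,\dots,\eta_L)\in\{0,1\}^L$ ($\eta_i=1$ if site $i$ is occupied, $0$ if empty), with parameters $\alpha,\beta>0$ and the following transitions. Bulk: for each pair of neighbouring sites $(i,i+1)$, $1\le i\le L-1$, $10\to 01$ with rate $1$ and $11\to 00$ with rate $1$. Left boundary: at site $1$, $0\to 1$ with rate $\alpha$ and $1\to 0$ with rate $\alpha$. Right boundary: at site $L$, $1\to0$ with rate $\beta$. The bracket $\langle\cdot\rangle$ denotes expectation with respect to the unique stationary distribution of this chain. *)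

(* Defs.v *)
From HB Require Import structures.
From mathcomp Require Import all_boot all_order all_algebra.

Set Implicit Arguments.
Unset Strict Implicit.
Unset Printing Implicit Defensive.

Import Order.TTheory GRing.Theory Num.Theory.
Local Open Scope ring_scope.

(* A continuous-time Markov chain on a finite type [T] is given by its
   transition rates [q x y], [x != y]; the values [q x x] are never used. *)

(* Global balance: for every state, the inflow equals the outflow, i.e. the
   master equation with vanishing time derivative. *)
Definition balanced (R : realFieldType) (T : finType) (q : T -> T -> R)
    (p : {ffun T -> R}) : Prop :=
  forall y, \sum_(x | x != y) p x * q x y = p y * \sum_(x | x != y) q y x.

Definition stationary_distribution (R : realFieldType) (T : finType)
    (q : T -> T -> R) (p : {ffun T -> R}) : Prop :=
  [/\ forall x, 0 <= p x, \sum_x p x = 1 & balanced q p].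

Definition expectation (R : realFieldType) (T : finType)
    (p : {ffun T -> R}) (f : T -> R) : R :=
  \sum_x p x * f x.

(* Sites are numbered from 0: the site [i.+1] of the 1-based convention is
   [i : 'I_L], and [eta i = true] means that the site is occupied. *)

Notation config L := {ffun 'I_L -> bool}.

Definition set1site L (eta : config L) (i : 'I_L) (a : bool) : config L :=
  finfun [eta eta with i |-> a].

Definition set2sites L (eta : config L) (i j : 'I_L) (a b : bool) : config L :=
  finfun [eta eta with i |-> a, j |-> b].

(* In the rates below every elementary transition contributes its own rate, so
   rates add up when two transitions have the same effect (as the removals at
   the two boundaries do when L = 1). *)

Definition bulk_rate (R : realFieldType) L (eta xi : config L) : R :=
  \sum_(i < L) \sum_(j < L | j == i.+1 :> nat)
     ([&& eta i, ~~ eta j & xi == set2sites eta i j false true]%:R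
      + [&& eta i, eta j & xi == set2sites eta i j false false]%:R).

Definition left_rate (R : realFieldType) (alpha : R) L (eta xi : config L) : R :=
  \sum_(i < L | i == 0%N :> nat)
     (alpha * (~~ eta i && (xi == set1site eta i true))%:R
      + alpha * (eta i && (xi == set1site eta i false))%:R).

Definition right_rate (R : realFieldType) (beta : R) L (eta xi : config L) : R :=
  \sum_(i < L | i.+1 == L :> nat)
     beta * (eta i && (xi == set1site eta i false))%:R.

Definition aap_rate (R : realFieldType) (alpha beta : R) L (eta xi : config L)
    : R :=
  bulk_rate R eta xi + left_rate alpha eta xi + right_rate beta eta xi.

Lemma balanced_norm (R : realFieldType) (T : finType) (q : T -> T -> R)
    (p : {ffun T -> R}) :
  (forall x y, 0 <= q x y) -> balanced q p -> balanced q [ffun x => `|p x|].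
Proof.
move=> q0 bp.
have out0 y : 0 <= \sum_(x | x != y) q y x by apply: sumr_ge0.
have le_y y : `|p y| * (\sum_(x | x != y) q y x)
    <= \sum_(x | x != y) `|p x| * q x y.
  rewrite -[X in _ * X](ger0_norm (out0 y)) -normrM -bp.
  apply: le_trans (ler_norm_sum _ _ _) _.
  by apply: ler_sum => x _; rewrite normrM (ger0_norm (q0 _ _)).
have eq_sum : \sum_y (\sum_(x | x != y) `|p x| * q x y)
    = \sum_y `|p y| * (\sum_(x | x != y) q y x).
  under [RHS]eq_bigr => y _ do rewrite mulr_sumr.
  rewrite (exchange_big_dep xpredT) //=.
  by apply: eq_bigr => x _; apply: eq_bigl => y; rewrite eq_sym.
move=> y; rewrite ffunE; under eq_bigr => x _ do rewrite ffunE.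
apply/eqP; rewrite -subr_eq0; apply/eqP.
have := @psumr_eq0P R T xpredT (fun y => \sum_(x | x != y) `|p x| * q x y
    - `|p y| * (\sum_(x | x != y) q y x)).
apply => //.
  by move=> i _; rewrite subr_ge0.
by rewrite sumrB eq_sum subrr.
Qed.

Lemma balanced_neq0 (R : realFieldType) (T : finType) (q : T -> T -> R)
    (x0 : T) : exists2 p : {ffun T -> R}, balanced q p & exists x, p x != 0.
Proof.
pose Q : 'M[R]_#|T| := \matrix_(i, j)
  if i == j then - \sum_(z | z != enum_val i) q (enum_val i) z
  else q (enum_val i) (enum_val j).
have sumT (F : T -> R) (P : pred T) :
    \sum_(i < #|T| | P (enum_val i)) F (enum_val i) = \sum_(x | P x) F x.
  by rewrite [RHS](reindex (@enum_val T T)) //; apply/onW_bij/enum_val_bij.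
have detQ : \det Q == 0.
  rewrite -det_tr; apply/det0P; exists (const_mx 1).
    apply/eqP => /rowP /(_ (enum_rank x0)) /eqP.
    by rewrite !mxE oner_eq0.
  apply/rowP => i; rewrite !mxE (bigD1 i) //= !mxE eqxx mul1r.
  under eq_bigr => j ji do rewrite !mxE mul1r eq_sym (negbTE ji).
  rewrite -(sumT (fun z => q (enum_val i) z) (fun z => z != enum_val i)).
  under [X in - X]eq_bigl => j do rewrite (inj_eq enum_val_inj).
  by rewrite addNr.
have [v v0 vQ] := det0P detQ.
exists [ffun x => v ord0 (enum_rank x)].
  move=> y; rewrite ffunE; under eq_bigr => x _ do rewrite ffunE.
  have /rowP/(_ (enum_rank y)) := vQ.
  rewrite !mxE (bigD1 (enum_rank y)) //= !mxE eqxx enum_rankK mulrN addrC.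
  move/eqP; rewrite subr_eq0 => /eqP <-.
  rewrite -(sumT (fun x => v ord0 (enum_rank x) * q x y) (fun x => x != y)).
  have rankE (i : 'I_#|T|) : (i == enum_rank y) = (enum_val i == y).
    by rewrite -[in RHS](can_eq enum_rankK) enum_valK.
  apply: eq_big => i; rewrite ?rankE // => iy.
  by rewrite !mxE rankE (negbTE iy) enum_valK enum_rankK.
have /rV0Pn[i vi] := v0.
by exists (enum_val i); rewrite ffunE enum_valK.
Qed.

Lemma stationary_distribution_exists (R : realFieldType) (T : finType)
    (q : T -> T -> R) (x0 : T) :
  (forall x y, 0 <= q x y) -> exists p, stationary_distribution q p.
Proof.
move=> q0; have [p bp [x px]] := balanced_neq0 q x0.
have := balanced_norm q0 bp; set r := finfun _ => br.
have r0 z : 0 <= r z by rewrite ffunE.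
have s_gt0 : 0 < \sum_z r z.
  rewrite (bigD1 x) //= ltr_pwDl ?sumr_ge0 //.
  by rewrite ffunE normr_gt0.
exists [ffun z => r z / \sum_z r z]; split.
- by move=> z; rewrite ffunE divr_ge0 // ltW.
- under eq_bigr => z _ do rewrite ffunE.
  by rewrite -mulr_suml divff // gt_eqF.
move=> y; rewrite ffunE mulrAC -br mulr_suml.
by apply: eq_bigr => z _; rewrite ffunE mulrAC.
Qed.

Lemma balanced_gt0 (R : realFieldType) (T : finType) (q : T -> T -> R)
    (p : {ffun T -> R}) (x y : T) :
  (forall x y, 0 <= q x y) -> (forall x, 0 <= p x) -> balanced q p ->
  x != y -> 0 < p x -> 0 < q x y -> 0 < p y.
Proof.
move=> q0 p0 bp xy px qxy; rewrite lt0r p0 andbT; apply/eqP => py.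
have := bp y; rewrite py mul0r (bigD1 x) //= => /eqP; rewrite gt_eqF //.
rewrite ltr_pwDl ?mulr_gt0 // sumr_ge0 // => z _; exact: mulr_ge0.
Qed.

(* [x0] is reachable from every state: [m] decreases along a path to it. *)
Lemma stationary_distribution_unique (R : realFieldType) (T : finType)
    (q : T -> T -> R) (x0 : T) (m : T -> nat) (p p' : {ffun T -> R}) :
  (forall x y, 0 <= q x y) ->
  (forall x, x != x0 -> exists2 y, (m y < m x)%N & 0 < q x y) ->
  stationary_distribution q p -> stationary_distribution q p' -> p = p'.
Proof.
move=> q0 down [_ p1 bp] [_ p'1 bp'].
have reach (r : {ffun T -> R}) x : (forall x, 0 <= r x) -> balanced q r ->
    0 < r x -> 0 < r x0.
  move=> r0 br; elim: {x}_.+1 {-2}x (ltnSn (m x)) => // n IHn x mx rx.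
  have [<- //|/down[y yx qxy]] := eqVneq x x0.
  apply: (IHn y); first exact: leq_trans yx _.
  apply: (balanced_gt0 (x := x) (y := y) q0 r0 br) => //.
  by apply: contraTneq yx => ->; rewrite ltnn.
pose v := [ffun x => p x - p' x].
have bv : balanced q v.
  move=> y; under eq_bigr => x _ do rewrite ffunE mulrBl.
  by rewrite sumrB bp bp' -mulrBl ffunE.
have bn := balanced_norm q0 bv.
have v_sum : \sum_x v x = 0.
  by under eq_bigr => x _ do rewrite ffunE; rewrite sumrB p1 p'1 subrr.
have pos (e : R) : `|e| = 1 -> (exists x, v x != 0) -> 0 < e * v x0.
  move=> e1 [x vx].
  have abs_ev z : `|e * v z| = `|v z| by rewrite normrM e1 mul1r.
  pose r := [ffun z => `|v z| + e * v z].
  have r0 z : 0 <= r z.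
    by rewrite ffunE -abs_ev -normrN -[X in _ + X]opprK subr_ge0 ler_norm.
  have br : balanced q r.
    move=> y; have := bn y; under eq_bigr => z _ do rewrite ffunE.
    rewrite ffunE => bny.
    under eq_bigr => z _ do rewrite ffunE mulrDl -mulrA.
    by rewrite big_split /= -mulr_sumr bv bny [r y]ffunE mulrDl mulrA.
  have [z rz] : exists z, 0 < r z.
    have [/existsP //|/existsPn nr] := boolP [exists z, 0 < r z].
    have rz z : r z = 0 by apply/eqP; move: (nr z); rewrite lt0r r0 andbT negbK.
    have : \sum_z `|v z| = 0.
      transitivity (\sum_z (r z - e * v z)).
        by apply: eq_bigr => z _; rewrite [r z]ffunE addrK.
      by rewrite sumrB -mulr_sumr v_sum mulr0 subr0 big1.
    move/psumr_eq0P => /(_ (fun _ _ => normr_ge0 _)) /(_ x isT) /eqP.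
    by rewrite normr_eq0 (negbTE vx).
  have := reach r z r0 br rz; rewrite ffunE -abs_ev.
  have [v0|v0] := leP 0 (e * v x0); last by rewrite ltr0_norm // addNr ltxx.
  by rewrite ger0_norm // -mulr2n pmulrn_lgt0.
apply/ffunP => x; apply/eqP; rewrite -subr_eq0; apply/negPn/negP => vx.
have ex : exists x, v x != 0 by exists x; rewrite ffunE.
have := pos 1 (normr1 _) ex; have := pos (-1) (normrN1 _) ex.
by rewrite mulN1r mul1r oppr_gt0 => /lt_trans h /h; rewrite ltxx.
Qed.

Lemma aap_rate_ge0 (R : realFieldType) (alpha beta : R) L (eta xi : config L) :
  0 < alpha -> 0 < beta -> 0 <= aap_rate alpha beta eta xi.
Proof.
move=> /ltW a0 /ltW b0; rewrite !addr_ge0 // sumr_ge0 // => i _.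
- by rewrite sumr_ge0 // => j _; rewrite addr_ge0.
- by rewrite addr_ge0 ?mulr_ge0.
- by rewrite mulr_ge0.
Qed.

Lemma aap_rate_down (R : realFieldType) (alpha beta : R) L (eta : config L) :
  0 < alpha -> 0 < beta -> eta != [ffun=> false] ->
  exists2 xi : config L,
    (\sum_(i < L) xi i * (L - i) < \sum_(i < L) eta i * (L - i))%N
    & 0 < aap_rate alpha beta eta xi.
Proof.
move=> a0 b0 /eqP eta0.
have [i ei] : exists i, eta i.
  have [/existsP //|/existsPn h] := boolP [exists i, eta i].
  by case: eta0; apply/ffunP => i; rewrite ffunE (negbTE (h i)).
have Li : (0 < L - i)%N by rewrite subn_gt0.
have bulk0 xi : 0 <= bulk_rate R eta xi.
  by rewrite sumr_ge0 // => ? _; rewrite sumr_ge0 // => ? _; rewrite addr_ge0.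
have left0 xi : 0 <= left_rate alpha eta xi.
  by rewrite sumr_ge0 // => ? _; rewrite addr_ge0 // mulr_ge0 // ltW.
have right0 xi : 0 <= right_rate beta eta xi.
  by rewrite sumr_ge0 // => ? _; rewrite mulr_ge0 // ltW.
have [iL|iL] := eqVneq i.+1 L.
  exists (set1site eta i false).
    rewrite (bigD1 i) //= [X in (_ < X)%N](bigD1 i) //= ffunE /= eqxx ei mul1n.
    rewrite mul0n add0n -[X in (X < _)%N]add0n -addSn leq_add //.
    by apply: leq_sum => j ji; rewrite ffunE /= (negbTE ji).
  rewrite ltr_wpDl ?addr_ge0 // /right_rate (bigD1 i) ?iL //= ei eqxx mulr1.
  by rewrite ltr_pwDl // sumr_ge0 // => j _; rewrite mulr_ge0 // ltW.
have jL : (i.+1 < L)%N by rewrite ltn_neqAle iL ltn_ord.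
pose j := Ordinal jL.
have ji : j != i by rewrite -val_eqE /= gtn_eqF.
exists (set2sites eta i j false (~~ eta j)).
  rewrite (bigD1 i) //= [X in (_ < X)%N](bigD1 i) //= ffunE /= eqxx ei mul1n.
  rewrite mul0n add0n (bigD1 j) //= [X in (_ < _ + X)%N](bigD1 j) //= ffunE /=.
  rewrite (negbTE ji) eqxx addnA -addSn leq_add //; last first.
    apply: leq_sum => z /andP[zi zj].
    by rewrite ffunE /= (negbTE zi) (negbTE zj).
  have Lj : (L - i.+1 < L - i)%N by apply: ltn_sub2l.
  by case: (eta j); rewrite ?mul0n ?mul1n ?addn0 ?ltn_addr.
rewrite /aap_rate -addrA ltr_pwDl ?addr_ge0 //.
rewrite /bulk_rate (bigD1 i) //= ltr_pwDl //; last first.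
  by rewrite sumr_ge0 // => ? _; rewrite sumr_ge0 // => ? _; rewrite addr_ge0.
rewrite (bigD1 j) //= ltr_pwDl //; last first.
  by rewrite sumr_ge0 // => ? _; rewrite addr_ge0.
by rewrite ei /=; case: (eta j); rewrite /= eqxx ?addr0 ?add0r ltr01.
Qed.

Theorem aap_stationary_distribution_exists_unique (R : realFieldType)
    (alpha beta : R) L :
  0 < alpha -> 0 < beta ->
  exists! p, stationary_distribution (@aap_rate R alpha beta L) p.
Proof.
move=> a0 b0; have q0 eta xi := @aap_rate_ge0 R alpha beta L eta xi a0 b0.
have [p sp] := stationary_distribution_exists [ffun=> false] q0.
exists p; split => // p' sp'.
apply: stationary_distribution_unique q0 _ sp sp'.
by move=> eta; apply: aap_rate_down.
Qed.

(* Main.v *)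
(* Transfer matrices.  In blocks indexed by the occupation of the first site
   (empty first), let s flip the first site, let N_L be the generator, acting on
   column vectors, of the bulk and the right boundary on L sites, and let
     Y_(L+1) = [2 Y_L, Y_L s; 0, Y_L].
   Induction on L gives Y N = N Y and s Y = Y (s + s N - N s); hence if w is
   stationary on L sites, i.e. N w = alpha (w - s w), then the vector
   (Y (s + 1/alpha) w, Y w) is stationary on L+1 sites.  As all the columns of
   Y_L have the sum (1 + beta) 2^(L-1) and Y is block triangular, the first k+1
   sites of the new vector are occupied with the probability of the first k
   sites of w times alpha / (2^k (1 + 2 alpha)). *)

Require Import Defs.
From mathcomp Require Import all_boot all_order all_algebra.
From mathcomp Require Import ring.

Set Implicit Arguments.
Unset Strict Implicit.
Unset Printing Implicit Defensive.

Import Order.TTheory GRing.Theory Num.Theory.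
Local Open Scope ring_scope.

(** * Configurations, flips and splitting off the first site *)

Definition flip L (y : config L) (i : 'I_L) : config L :=
  set1site y i (~~ y i).

Lemma flipE L (y : config L) i j : flip y i j = (i == j) (+) y j.
Proof. by rewrite ffunE /= eq_sym; case: eqP => [->|]. Qed.

Lemma flipK L (i : 'I_L) : involutive ((@flip L)^~ i).
Proof. by move=> y; apply/ffunP => j; rewrite !flipE addbA addbb. Qed.

Lemma flipC L (y : config L) i j : flip (flip y i) j = flip (flip y j) i.
Proof. by apply/ffunP => k; rewrite !flipE addbCA. Qed.

Definition ccons L (b : bool) (y : config L) : config L.+1 :=
  [ffun i => oapp y b (unlift ord0 i)].

Definition cbehead L (y : config L.+1) : config L :=
  [ffun i => y (lift ord0 i)].

Lemma ccons0 L b (y : config L) : ccons b y ord0 = b.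
Proof. by rewrite ffunE unlift_none. Qed.

Lemma cconsS L b (y : config L) i : ccons b y (lift ord0 i) = y i.
Proof. by rewrite ffunE liftK. Qed.

Lemma ccons_behead L (y : config L.+1) : ccons (y ord0) (cbehead y) = y.
Proof.
by apply/ffunP => i; rewrite ffunE; case: unliftP => [j ->|->] //=; rewrite ffunE.
Qed.

Lemma cbehead_cons L b (y : config L) : cbehead (ccons b y) = y.
Proof. by apply/ffunP => i; rewrite ffunE cconsS. Qed.

Lemma flip_cons0 L b (y : config L) : flip (ccons b y) ord0 = ccons (~~ b) y.
Proof.
apply/ffunP => i; rewrite flipE; case: (unliftP ord0 i) => [j ->|->].
  by rewrite !cconsS (negbTE (neq_lift _ _)).
by rewrite !ccons0 eqxx.
Qed.

Lemma flip_consS L b (y : config L) i :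
  flip (ccons b y) (lift ord0 i) = ccons b (flip y i).
Proof.
apply/ffunP => j; rewrite flipE; case: (unliftP ord0 j) => [k ->|->].
  by rewrite !cconsS flipE (inj_eq lift_inj).
by rewrite !ccons0 eq_sym (negbTE (neq_lift _ _)).
Qed.

Lemma sum_config (V : nmodType) L (F : config L.+1 -> V) :
  \sum_y F y = \sum_y F (ccons false y) + \sum_y F (ccons true y).
Proof.
rewrite (reindex (fun z : bool * config L => ccons z.1 z.2)) /=; last first.
  exists (fun y : config L.+1 => (y ord0, cbehead y)) => [[b y]|y] _ /=.
    by rewrite ccons0 cbehead_cons.
  exact: ccons_behead.
rewrite -(pair_bigA _ (fun b y => F (ccons b y))) /=.
by rewrite big_bool addrC.
Qed.

(** * The first-site flip and the generator as operators on functions *)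

Definition flip0 (A : Type) L (v : config L.+1 -> A) (y : config L.+1) : A :=
  v (flip y ord0).

Lemma sum_flip0 (V : nmodType) L (F : config L.+1 -> V) :
  \sum_y flip0 F y = \sum_y F y.
Proof. by rewrite [RHS](reindex_inj (inv_inj (flipK ord0))). Qed.

(* The part of the master equation due to the bulk and the right boundary: each
   of its transitions empties an occupied site [i] and flips [i.+1], if any. *)
Definition gen (R : comNzRingType) (beta : R) L (v : config L -> R) (y : config L)
    : R :=
  \sum_(i < L) \sum_(j < L | j == i.+1 :> nat)
     (if y i then - v y else v (flip (flip y i) j))
  + \sum_(i < L | i.+1 == L :> nat)
     beta * (if y i then - v y else v (flip y i)).

Lemma gen1 (R : comNzRingType) (beta : R) (v : config 1 -> R) y :
  gen beta v y = beta * (if y ord0 then - v y else v (flip y ord0)).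
Proof.
by rewrite /gen big_ord1 big_pred0 ?add0r => [|i]; rewrite ?(big_mkcond, ord1) //= big_ord1.
Qed.

(** A new first site adds only the bond to the old first site, so the generator has the block form
    [[N, s; 0, N - 1]]. *)
Lemma gen_cons (R : comNzRingType) (beta : R) L (v : config L.+2 -> R) b y :
  gen beta v (ccons b y) = gen beta (fun z => v (ccons b z)) y
  + (if b then - v (ccons b y) else v (ccons true (flip y ord0))).
Proof.
have sumS (P : pred nat) (F : 'I_L.+2 -> R) : P 0%N = false ->
    \sum_(j < L.+2 | P j) F j
    = \sum_(j < L.+1 | P j.+1) F (lift ord0 j).
  by move=> P0; rewrite big_mkcond big_ord_recl /= P0 add0r -big_mkcond.
rewrite /gen big_ord_recl (sumS (fun j => j.+1 == L.+2)) //.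
rewrite (sumS (fun j => j == 1%N)) //.
rewrite (eq_bigl (xpred1 ord0)) => [|j]; last by rewrite -val_eqE.
rewrite big_pred1_eq ccons0 flip_cons0 flip_consS -addrA [RHS]addrC.
congr (_ + (_ + _)); first by case: b.
- apply: eq_bigr => i _; rewrite (sumS (fun j => j == i.+2)) //.
  by apply: eq_bigr => j _; rewrite cconsS !flip_consS.
by apply: eq_bigr => i _; rewrite cconsS flip_consS.
Qed.

Lemma gen_ext (R : comNzRingType) (beta : R) L (u v : config L -> R) :
  u =1 v -> gen beta u =1 gen beta v.
Proof.
move=> uv y; rewrite /gen; congr (_ + _); apply: eq_bigr => i _.
  by apply: eq_bigr => j _; rewrite !uv.
by rewrite !uv.
Qed.

Lemma gen_lin (R : comNzRingType) (beta : R) L a (u v : config L -> R) y :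
  gen beta (fun z => a * u z + v z) y = a * gen beta u y + gen beta v y.
Proof.
rewrite /gen mulrDr addrACA !mulr_sumr -!big_split /=; congr (_ + _).
  apply: eq_bigr => i _; rewrite mulr_sumr -big_split /=.
  by apply: eq_bigr => j _; case: ifP => // _; rewrite mulrN opprD.
by apply: eq_bigr => i _; case: ifP => // _; ring.
Qed.

(** * The transfer matrix and its commutation relations *)

(** This is [Y] on [L.+1] sites, as an operator on functions. The one-site matrix is
    [[1 + beta, beta; 0, 1]], both of whose columns have sum [1 + beta]. *)
Fixpoint intertwiner (R : comNzRingType) (beta : R) L :
    (config L.+1 -> R) -> config L.+1 -> R :=
  match L with
  | 0 => fun v y =>
      if y ord0 then v y else (1 + beta) * v y + beta * v (flip y ord0)
  | L'.+1 => fun v y =>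
      let Y := @intertwiner R beta L' in
      if y ord0 then Y (fun z => v (ccons true z)) (cbehead y)
      else 2 * Y (fun z => v (ccons false z)) (cbehead y)
           + Y (fun z => flip0 (fun x => v (ccons true x)) z) (cbehead y)
  end.

Lemma intertwinerS (R : comNzRingType) (beta : R) L (v : config L.+2 -> R) b y :
  intertwiner beta v (ccons b y) =
  if b then intertwiner beta (fun z => v (ccons true z)) y
  else 2 * intertwiner beta (fun z => v (ccons false z)) y
       + intertwiner beta (fun z => flip0 (fun x => v (ccons true x)) z) y.
Proof. by rewrite /= ccons0 cbehead_cons. Qed.

Lemma intertwiner_ext (R : comNzRingType) (beta : R) L (u v : config L.+1 -> R) :
  u =1 v -> intertwiner beta u =1 intertwiner beta v.
Proof.
elim: L u v => [|L IH] u v uv y; first by rewrite /= !uv.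
rewrite -(ccons_behead y) !intertwinerS.
by case: ifP => _; rewrite !(IH _ _ (fun z => uv (ccons _ _))).
Qed.

Lemma intertwiner_lin (R : comNzRingType) (beta : R) L a (u v : config L.+1 -> R)
    y :
  intertwiner beta (fun z => a * u z + v z) y
  = a * intertwiner beta u y + intertwiner beta v y.
Proof.
elim: L u v y => [|L IH] u v y /=; first by case: ifP => // _; ring.
by rewrite !IH; case: ifP => // _; ring.
Qed.

Lemma intertwinerZ (R : comNzRingType) (beta : R) L a (v : config L.+1 -> R) y :
  intertwiner beta (fun z => a * v z) y = a * intertwiner beta v y.
Proof.
elim: L v y => [|L IH] v y /=; first by case: ifP => // _; ring.
by rewrite !IH; case: ifP => // _; ring.
Qed.

Lemma intertwiner_ge0 (R : realFieldType) (beta : R) L (v : config L.+1 -> R) :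
  0 <= beta -> (forall y, 0 <= v y) -> forall y, 0 <= intertwiner beta v y.
Proof.
move=> b0; elim: L v => [|L IH] v v0 y /=; case: ifP => // _.
- by rewrite addr_ge0 ?mulr_ge0 ?addr_ge0 ?ler01.
- by apply: IH => z; apply: v0.
by rewrite addr_ge0 ?mulr_ge0 ?IH ?ler0n // => z; apply: v0.
Qed.

(** The two identities are proved together: the block [s] of the generator produces [s Y] in the
    first one, which is then resolved by the second one on one site fewer. The inductive step of the
    second follows from the block forms alone. *)
Lemma intertwiner_gen (R : comNzRingType) (beta : R) L (v : config L.+1 -> R) y :
  intertwiner beta (gen beta v) y = gen beta (intertwiner beta v) y
  /\ flip0 (intertwiner beta v) y
    = intertwiner beta (flip0 v) y + intertwiner beta (flip0 (gen beta v)) y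
      - intertwiner beta (gen beta (flip0 v)) y.
Proof.
elim: L v y => [|L IH] v y.
  rewrite /flip0 /=; rewrite !gen1 /= !flipE eqxx !flipK.
  by case: (y ord0) => /=; split; ring.
have IHg (u : config L.+1 -> R) z : gen beta (intertwiner beta u) z = intertwiner beta (gen beta u) z.
  by have [] := IH u z.
have IHf (u : config L.+1 -> R) z := (IH u z).2.
(* Next come the blocks of [N v], [Y v], [s v], [N s v] and [s N v]. Coefficients [1] and [-1] are
   kept explicit to fit the shape required by [intertwiner_lin]. *)
pose v0 z := v (ccons false z); pose v1 z := v (ccons true z).
have g0 : (fun z => gen beta v (ccons false z))
    =1 (fun z => 1 * gen beta v0 z + flip0 v1 z).
  by move=> z; rewrite gen_cons mul1r.
have g1 : (fun z => gen beta v (ccons true z))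
    =1 (fun z => (-1) * v1 z + gen beta v1 z).
  by move=> z; rewrite gen_cons mulN1r addrC.
have Y1 : (fun z => intertwiner beta v (ccons true z)) =1 intertwiner beta v1.
  by move=> z; rewrite intertwinerS.
have Y0 : (fun z => intertwiner beta v (ccons false z))
    =1 (fun z => 2 * intertwiner beta v0 z + intertwiner beta (flip0 v1) z).
  by move=> z; rewrite intertwinerS.
have f1 : flip0 (fun z => gen beta v (ccons true z))
    =1 (fun z => (-1) * flip0 v1 z + flip0 (gen beta v1) z).
  by move=> z; rewrite /flip0 g1.
have gf0 : (fun z => gen beta (flip0 v) (ccons false z))
    =1 (fun z => 1 * gen beta v1 z + flip0 v0 z).
  move=> z; rewrite gen_cons /flip0 flip_cons0 mul1r; congr (_ + _).
  by apply: gen_ext => x; rewrite flip_cons0.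
have gf1 : (fun z => gen beta (flip0 v) (ccons true z))
    =1 (fun z => (-1) * v0 z + gen beta v0 z).
  move=> z; rewrite gen_cons /flip0 flip_cons0 mulN1r addrC; congr (_ + _).
  by apply: gen_ext => x; rewrite flip_cons0.
have fg0 : (fun z => flip0 (gen beta v) (ccons false z))
    =1 (fun z => (-1) * v1 z + gen beta v1 z).
  by move=> z; rewrite /flip0 flip_cons0 g1.
have fg1 : (fun z => flip0 (gen beta v) (ccons true z))
    =1 (fun z => 1 * gen beta v0 z + flip0 v1 z).
  by move=> z; rewrite /flip0 flip_cons0 g0.
have ff (u : config L.+1 -> R) : flip0 (flip0 u) =1 u.
  by move=> z; rewrite /flip0 flipK.
have fv0 : (fun z => flip0 v (ccons false z)) =1 v1.
  by move=> z; rewrite /flip0 flip_cons0.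
have fv1 : (fun z => flip0 v (ccons true z)) =1 v0.
  by move=> z; rewrite /flip0 flip_cons0.
have flip0_ext (u u' : config L.+1 -> R) : u =1 u' -> flip0 u =1 flip0 u'.
  by move=> uu z; apply: uu.
rewrite -(ccons_behead y); case: (y ord0); move: (cbehead y) => {}y; split.
- rewrite gen_cons !intertwinerS (gen_ext _ Y1) (intertwiner_ext _ g1).
  by rewrite intertwiner_lin IHg; ring.
- rewrite [LHS]/flip0 flip_cons0 !intertwinerS.
  rewrite (intertwiner_ext _ fv1) (intertwiner_ext _ fg1) (intertwiner_ext _ gf1).
  by rewrite !intertwiner_lin; ring.
- rewrite gen_cons !intertwinerS (gen_ext _ Y0) (intertwiner_ext _ g0).
  rewrite (intertwiner_ext _ f1) !intertwiner_lin gen_lin.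
  (* The transition across the first bond contributes [s Y v1], which the second identity expresses
     through [Y]. *)
  rewrite -[intertwiner _ _ (flip y ord0)]/(flip0 (intertwiner beta v1) y) IHf.
  by rewrite !IHg; ring.
rewrite [LHS]/flip0 flip_cons0 !intertwinerS.
rewrite (intertwiner_ext _ fv0) (intertwiner_ext _ fg0) (intertwiner_ext _ gf0).
rewrite (intertwiner_ext _ (flip0_ext _ _ fv1)).
rewrite (intertwiner_ext _ (flip0_ext _ _ fg1)).
rewrite (intertwiner_ext _ (flip0_ext _ _ gf1)).
rewrite /flip0 !intertwiner_lin.
rewrite -/(flip0 v0) -/(flip0 v1) -/(flip0 (gen beta v0)).
rewrite (intertwiner_ext _ (ff v1)).
by ring.
Qed.

(** * Unnormalized stationary weights *)

(** A single site fills at rate [alpha] and empties at rate [alpha + beta], which gives the initial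
    weights; the recursion is [w] to [(Y (s + 1/alpha) w, Y w)]. *)
Fixpoint weight (R : realFieldType) (alpha beta : R) n : config n.+1 -> R :=
  match n with
  | 0 => fun y => if y ord0 then alpha else alpha + beta
  | n'.+1 => fun y =>
      let w := @weight R alpha beta n' in
      if y ord0 then intertwiner beta w (cbehead y)
      else alpha^-1 * intertwiner beta w (cbehead y)
           + intertwiner beta (flip0 w) (cbehead y)
  end.

Lemma weightS (R : realFieldType) (alpha beta : R) n b (y : config n.+1) :
  weight alpha beta (ccons b y) =
  if b then intertwiner beta (weight alpha beta (n := n)) y
  else alpha^-1 * intertwiner beta (weight alpha beta (n := n)) y
       + intertwiner beta (flip0 (weight alpha beta (n := n))) y.
Proof. by rewrite /= ccons0 cbehead_cons. Qed.

Lemma weight_ge0 (R : realFieldType) (alpha beta : R) n (y : config n.+1) :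
  0 <= alpha -> 0 <= beta -> 0 <= weight alpha beta y.
Proof.
move=> a0 b0; elim: n y => [|n IH] y /=; case: ifP => // _.
- exact: addr_ge0.
- exact: intertwiner_ge0.
rewrite addr_ge0 ?mulr_ge0 ?invr_ge0 ?intertwiner_ge0 // => z; exact: IH.
Qed.

(** In the occupied block, the term with [alpha^-1] compensates the loss through the first bond,
    leaving [Y] applied to the equation for [w]. In the empty block, [N Y s w] cancels the term
    [Y N s w] of [s Y w], and the equation for [w] and its flip eliminate [N w] and [s N w]. *)
Lemma weight_master (R : realFieldType) (alpha beta : R) n (y : config n.+1) :
  alpha != 0 ->
  gen beta (weight alpha beta (n := n)) y
  + alpha * (flip0 (weight alpha beta (n := n)) y - weight alpha beta y) = 0.
Proof.
move=> a0; elim: n y => [|n IH] y.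
  rewrite gen1 /flip0 /= !flipE eqxx.
  by case: (y ord0) => /=; ring.
pose w := @weight R alpha beta n.
have gw : gen beta w =1 (fun z => (- alpha) * flip0 w z + alpha * w z).
  by move=> z; apply/eqP; rewrite -subr_eq0; apply/eqP; rewrite -(IH z) -/w; ring.
have W0 : (fun z => weight alpha beta (ccons false z))
    =1 (fun z => alpha^-1 * intertwiner beta w z + intertwiner beta (flip0 w) z).
  by move=> z; rewrite weightS.
have W1 : (fun z => weight alpha beta (ccons true z)) =1 intertwiner beta w.
  by move=> z; rewrite weightS.
have IHg (u : config n.+1 -> R) z := (intertwiner_gen beta u z).1.
have IHf (u : config n.+1 -> R) z := (intertwiner_gen beta u z).2.
have fgw : flip0 (gen beta w) =1 (fun z => (- alpha) * w z + alpha * flip0 w z).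
  by move=> z; rewrite /flip0 gw /flip0 flipK.
rewrite -(ccons_behead y) gen_cons /flip0 flip_cons0.
case: (y ord0); move: (cbehead y) => {}y /=; rewrite ?ccons0 ?cbehead_cons.
  rewrite (gen_ext _ W1) -IHg (intertwiner_ext _ gw) intertwiner_lin intertwinerZ.
  by rewrite -/w; field.
rewrite (gen_ext _ W0) gen_lin -!IHg (intertwiner_ext _ gw) intertwiner_lin intertwinerZ.
rewrite -[intertwiner _ _ (flip y ord0)]/(flip0 (intertwiner beta w) y) IHf.
rewrite (intertwiner_ext _ fgw) intertwiner_lin intertwinerZ -/w -/(flip0 w).
by field.
Qed.

(** * From the rates of the chain to the master equation *)

(** Both [10 -> 01] and [11 -> 00] flip the two sites of a bond whose left site is occupied, and the
    left boundary flips the first site unconditionally. Every transition is thus an involution under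
    a condition. *)
Lemma aap_rateE (R : realFieldType) (alpha beta : R) L (x y : config L) :
  aap_rate alpha beta x y =
  \sum_(i < L) \sum_(j < L | j == i.+1 :> nat)
     (x i && (y == flip (flip x i) j))%:R
  + \sum_(i < L | i == 0%N :> nat) alpha * (y == flip x i)%:R
  + \sum_(i < L | i.+1 == L :> nat) beta * (x i && (y == flip x i))%:R.
Proof.
rewrite /aap_rate /bulk_rate /left_rate /right_rate; congr (_ + _ + _).
- apply: eq_bigr => i _; apply: eq_bigr => j /eqP ji.
  have [xi|] := boolP (x i); last by rewrite addr0.
  have nij : (j == i) = false by rewrite -val_eqE /= ji gtn_eqF.
  have -> : flip (flip x i) j = set2sites x i j false (~~ x j).
    apply/ffunP => l; rewrite !flipE ffunE /=.
    have [->|li] := eqVneq l i; first by rewrite nij xi.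
    by rewrite eq_sym; case: eqVneq => [->|].
  by case: (x j); rewrite /= ?addr0 ?add0r.
- apply: eq_bigr => i _; rewrite /flip.
  by case: (x i); rewrite /= mulr0 ?addr0 ?add0r.
by apply: eq_bigr => i _; rewrite /flip; case: (x i).
Qed.

(** For an involution, [g y] is both the only possible source of a jump into [y] and the only target
    of a jump out of it. *)
Lemma net_flow_involution (R : comNzRingType) (T : finType) (g : T -> T)
    (a : pred T) (v : T -> R) y :
  involutive g -> g y != y ->
  \sum_(x | x != y) (v x * (a x && (y == g x))%:R - v y * (a y && (x == g y))%:R)
  = (a (g y))%:R * v (g y) - (a y)%:R * v y.
Proof.
move=> gK gy; rewrite (bigD1 (g y)) //= gK !eqxx !andbT big1 ?addr0.
  by rewrite ![_%:R * _]mulrC.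
move=> x /andP[xy xg]; rewrite (negbTE xg) andbF mulr0 subr0.
by rewrite -(inv_eq gK) eq_sym (negbTE xg) andbF mulr0.
Qed.

Lemma flip_neq L (y : config L) i : flip y i != y.
Proof.
by apply/eqP => /ffunP/(_ i); rewrite flipE eqxx; case: (y i).
Qed.

Lemma net_flow (R : realFieldType) (alpha beta : R) n (v : config n.+1 -> R) y :
  \sum_(x | x != y) v x * aap_rate alpha beta x y
  - v y * \sum_(x | x != y) aap_rate alpha beta y x
  = gen beta v y + alpha * (flip0 v y - v y).
Proof.
pose flow (c : R) (a : pred (config n.+1)) (g : config n.+1 -> config n.+1) x :=
  c * (v x * (a x && (y == g x))%:R - v y * (a y && (x == g y))%:R).
have flowE c a g : involutive g -> g y != y ->
    \sum_(x | x != y) flow c a g x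
    = c * ((a (g y))%:R * v (g y) - (a y)%:R * v y).
  by move=> gK gy; rewrite -mulr_sumr net_flow_involution.
pose bulk i j := flow 1 (fun x => x i) (fun x => flip (flip x i) j).
pose left i := flow alpha xpredT (fun x => flip x i).
pose right i := flow beta (fun x => x i) (fun x => flip x i).
(* The net flow is split by elementary transition, so that each part is the flow of one
   involution. *)
transitivity (\sum_(x | x != y)
    (\sum_(i < n.+1) \sum_(j < n.+1 | j == i.+1 :> nat) bulk i j x
     + \sum_(i < n.+1 | i == 0%N :> nat) left i x
     + \sum_(i < n.+1 | i.+1 == n.+1 :> nat) right i x)).
  rewrite mulr_sumr -sumrB; apply: eq_bigr => x _.
  rewrite !aap_rateE !mulrDr !mulr_sumr !opprD addrACA [X in X + _]addrACA.
  rewrite -!sumrB; congr (_ + _ + _); apply: eq_bigr => i _.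
  - rewrite !mulr_sumr -sumrB; apply: eq_bigr => j _.
    by rewrite /bulk /flow mul1r.
  - by rewrite /left /flow /=; ring.
  by rewrite /right /flow; ring.
rewrite !big_split /= /gen addrAC; congr (_ + _ + _).
- rewrite exchange_big; apply: eq_bigr => i _.
  rewrite exchange_big; apply: eq_bigr => j /eqP ji.
  have nij : (j == i) = false by rewrite -val_eqE /= ji gtn_eqF.
  rewrite flowE /=; last first.
  - by apply/eqP => /ffunP/(_ i); rewrite !flipE nij eqxx; case: (y i).
  - by move=> x; rewrite (flipC _ i j) !flipK.
  by rewrite !flipE nij eqxx /= mul1r; case: (y i) => /=; ring.
- rewrite exchange_big; apply: eq_bigr => i _.
  rewrite flowE ?flip_neq //; last exact: flipK.
  by rewrite flipE eqxx; case: (y i) => /=; ring.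
rewrite exchange_big (eq_bigl (xpred1 ord0)) => [|i]; last by rewrite -val_eqE.
rewrite big_pred1_eq flowE ?flip_neq //; last exact: flipK.
by rewrite /flip0 !mul1r.
Qed.

Lemma weight_balanced (R : realFieldType) (alpha beta : R) n (y : config n.+1) :
  alpha != 0 ->
  \sum_(x | x != y) weight alpha beta x * aap_rate alpha beta x y
  = weight alpha beta y * \sum_(x | x != y) aap_rate alpha beta y x.
Proof.
by move=> a0; apply/eqP; rewrite -subr_eq0 net_flow weight_master.
Qed.

(** * Total weight and weight of an occupied initial segment *)

Definition first_occupied L k (y : config L) : bool :=
  [forall i : 'I_L, (i < k)%N ==> y i].

Lemma first_occupied_cons L k b (y : config L) :
  first_occupied k.+1 (ccons b y) = b && first_occupied k y.
Proof.
apply/forallP/andP => [h|[hb /forallP h] i].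
  split; first by have := h ord0; rewrite ccons0.
  by apply/forallP => i; have := h (lift ord0 i); rewrite cconsS lift0.
case: (unliftP ord0 i) => [j|] ->; last by rewrite ccons0 hb implybT.
by rewrite cconsS lift0; apply: h.
Qed.

Lemma sum_first_occupiedS (R : comNzRingType) L k (v : config L.+1 -> R) :
  \sum_(y | first_occupied k.+1 y) v y
  = \sum_(y | first_occupied k y) v (ccons true y).
Proof.
rewrite big_mkcond sum_config big1 ?add0r => [|y _]; last first.
  by rewrite first_occupied_cons.
by rewrite [RHS]big_mkcond; apply: eq_bigr => y _; rewrite first_occupied_cons.
Qed.

(** These are the column sums of [Y]: the block columns [2 Y] over [0] and [Y s] over [Y] both
    double them, as [s] preserves totals. *)
Lemma sum_intertwiner (R : comNzRingType) (beta : R) L (v : config L.+1 -> R) :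
  \sum_y intertwiner beta v y = (1 + beta) * 2 ^+ L * \sum_y v y.
Proof.
elim: L v => [|L IH] v.
  rewrite expr0 mulr1 mulr_sumr !sum_config -!big_split /=.
  by apply: eq_bigr => y _; rewrite !ccons0 flip_cons0 /=; ring.
rewrite sum_config [in RHS]sum_config.
under eq_bigr => y _ do rewrite intertwinerS.
under [X in _ + X]eq_bigr => y _ do rewrite intertwinerS.
rewrite big_split /= -mulr_sumr !IH sum_flip0 exprS; ring.
Qed.

(** By triangularity, rows with an occupied first site see only such columns, through a smaller [Y].
    Stripping [k] sites leaves [Y] on [L - k + 1] sites, at least one, with its column sums. *)
Lemma sum_first_occupied_intertwiner (R : comNzRingType) (beta : R) L k
    (v : config L.+1 -> R) : (k <= L)%N ->
  \sum_(y | first_occupied k y) intertwiner beta v y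
  = (1 + beta) * 2 ^+ (L - k) * \sum_(y | first_occupied k y) v y.
Proof.
have all0 M (u : config M -> R) :
    \sum_(y | first_occupied 0 y) u y = \sum_y u y.
  by apply: eq_bigl => y; apply/forallP.
elim: L k v => [|L IH] [|k] v kL //; rewrite ?all0 ?subn0 ?sum_intertwiner //.
rewrite !sum_first_occupiedS subSS -(IH k (fun z => v (ccons true z))) //.
by apply: eq_bigr => y _; rewrite intertwinerS.
Qed.

Lemma sum_weightS (R : realFieldType) (alpha beta : R) n :
  \sum_y weight alpha beta (n := n.+1) y
  = (alpha^-1 + 2) * (1 + beta) * 2 ^+ n * \sum_y weight alpha beta (n := n) y.
Proof.
rewrite sum_config.
under eq_bigr => y _ do rewrite weightS.
under [X in _ + X]eq_bigr => y _ do rewrite weightS.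
by rewrite big_split /= -mulr_sumr !sum_intertwiner sum_flip0; ring.
Qed.

Lemma sum_weight_gt0 (R : realFieldType) (alpha beta : R) n :
  0 < alpha -> 0 < beta -> 0 < \sum_y weight alpha beta (n := n) y.
Proof.
move=> a0 b0; elim: n => [|n IH].
  rewrite (bigD1 [ffun=> true]) //= ffunE ltr_pwDl // sumr_ge0 // => y _.
  by case: ifP => _; rewrite ?addr_ge0 ?ltW.
by rewrite sum_weightS !mulr_gt0 ?exprn_gt0 ?addr_gt0 ?invr_gt0 ?ltr0n ?ltr01.
Qed.

Lemma sum_first_occupied_weight (R : realFieldType) (alpha beta : R) n k :
  alpha != 0 -> (k <= n)%N ->
  2 ^+ 'C(k, 2) * (1 + 2 * alpha) ^+ k
    * \sum_(y | first_occupied k y) weight alpha beta (n := n) y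
  = alpha ^+ k * \sum_y weight alpha beta (n := n) y.
Proof.
move=> a0; elim: k n => [|k IH] n kn.
  by rewrite !expr0 !mul1r; apply: eq_bigl => y; apply/forallP.
case: n kn => [//|n]; rewrite ltnS => kn.
rewrite sum_first_occupiedS.
under eq_bigr => y _ do rewrite weightS.
rewrite sum_first_occupied_intertwiner //.
rewrite sum_weightS.
(* Pascal's rule gives ['C(k.+1, 2) = 'C(k, 2) + k]; the factor [2 ^+ k] is the ratio of the column
   sums of [Y] on [n.+1] and on [n.+1 - k] sites. *)
rewrite binS bin1 exprD.
rewrite (_ : 2 ^+ n = 2 ^+ (n - k) * 2 ^+ k); last by rewrite -exprD subnK.
have := IH n kn.
set E := \sum_(y | _) _; set S := \sum_y _ => h.
transitivity ((1 + 2 * alpha) * (1 + beta) * 2 ^+ (n - k) * 2 ^+ k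
  * (2 ^+ 'C(k, 2) * (1 + 2 * alpha) ^+ k * E)).
  by rewrite exprS; ring.
by rewrite h exprS; field.
Qed.

Theorem corollary4 (R : realFieldType) (alpha beta : R) (L k : nat)
    (p : {ffun config L -> R}) :
  0 < alpha -> 0 < beta -> (1 <= k)%N -> (k + 1 < L)%N ->
  stationary_distribution (@aap_rate R alpha beta L) p ->
  expectation p (fun eta : config L => \prod_(i < L | (i < k)%N) (eta i)%:R)
  = alpha ^+ k / (2 ^+ 'C(k, 2) * (1 + 2 * alpha) ^+ k).
Proof.
move=> a_gt0 b_gt0 _; case: L p => [//|n] p; rewrite addn1 ltnS => /ltnW kn sp.
have a0 : alpha != 0 by rewrite gt_eqF.
pose w := @weight R alpha beta n.
have w0 y : 0 <= w y by rewrite weight_ge0 ?ltW.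
pose S := \sum_y w y.
have S_gt0 : 0 < S by exact: sum_weight_gt0.
(* The normalized weights are stationary, so uniqueness identifies them with [p]. *)
have p_eq : p = [ffun y => w y / S].
  have [q [_ uq]] :=
    @aap_stationary_distribution_exists_unique R alpha beta n.+1 a_gt0 b_gt0.
  rewrite -(uq p sp); apply: uq; split.
  - by move=> y; rewrite ffunE divr_ge0 // ltW.
  - under eq_bigr => y _ do rewrite ffunE.
    by rewrite -mulr_suml divff // gt_eqF.
  move=> y; rewrite ffunE; under eq_bigr => x _ do rewrite ffunE mulrAC.
  by rewrite -mulr_suml weight_balanced // mulrAC.
have D0 : 2 ^+ 'C(k, 2) * (1 + 2 * alpha) ^+ k != 0.
  rewrite mulf_neq0 ?expf_neq0 ?pnatr_eq0 // gt_eqF //.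
  by rewrite ltr_wpDl ?mulr_gt0 ?ltr0n.
(* The product of occupation numbers is the indicator of [first_occupied k]. *)
have -> : expectation p (fun y => \prod_(i < n.+1 | (i < k)%N) (y i)%:R)
    = (\sum_(y | first_occupied k y) w y) / S.
  rewrite /expectation mulr_suml [RHS]big_mkcond; apply: eq_bigr => y _.
  rewrite p_eq ffunE; case: ifPn => [/forallP h|/forallPn[i]].
    by rewrite big1 ?mulr1 // => i ik; have := h i; rewrite ik /= => ->.
  by rewrite negb_imply => /andP[ik /negbTE yi]; rewrite (bigD1 i) //= yi mul0r mulr0.
apply: (mulfI D0); rewrite mulrA sum_first_occupied_weight // mulfK ?gt_eqF //.
by rewrite mulrC divfK.
Qed.
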